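(* Let $\mathcal{A}$ be a generic arrangement of $n$ hyperplanes in $\mathbb{R}^k$, $k<n$, and let $X\in\mathcal{L}(\mathcal{B}(n,k,\mathcal{A}))$ be a minimal non-very generic intersection with canonical presentation $\{S_1,\dots,S_m\}$. Then $a_X\ge\frac{2|\bigcup_{i=1}^mS_i|}{k+1}$.
   Context: A central arrangement $\mathcal{A}=\{H_1,\dots,H_n\}$ in $\mathbb{R}^k$ ($k<n$), with normals $\alpha_i$, is generic if any $m\le k$ of its hyperplanes intersect in codimension $m$. Identify $\mathbb{R}^n$ with the space of parallel translates via $t\mapsto(H_i+t_i\alpha_i)_i$. For $L\subset[n]$, $|L|=k+1$, $D_L=\{t\mid\bigcap_{i\in L}(H_i+t_i\alpha_i)\ne\emptyset\}$; $\mathcal{B}(n,k,\mathcal{A})=\{D_L\}$ is the discriminantal arrangement with intersection poset $\mathcal{L}(\mathcal{B}(n,k,\mathcal{A}))$. For $|S|\ge k+1$, $D_S=\bigcap_{L\subset S,|L|=k+1}D_L$. $D_S$ is a component of $X$ if $X\subset D_S$ and $X\not\subset D_{S\cup\{j\}}$ for all $j\notin S$; the canonical presentation $\{S_1,\dots,S_m\}$ of $X$ is the set of index sets of all its components. Athanasiadis rank $a_X=\sum_i(|S_i|-k)$; $\operatorname{rank}(X)$ is the codimension; $X$ is very generic if $\operatorname{rank}(X)=a_X$, non-very generic otherwise. A non-very generic $X$ is minimal if every $Y\in\mathcal{L}$ with $Y\supsetneq X$ is very generic. *)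

(* Defs.v *)
From HB Require Import structures.
From mathcomp Require Import all_boot all_order all_algebra.
From mathcomp Require Import boolp classical_sets reals.
Set Implicit Arguments.
Unset Strict Implicit.
Unset Printing Implicit Defensive.
Import Order.TTheory GRing.Theory Num.Theory.
Local Open Scope classical_set_scope.
Local Open Scope ring_scope.

Definition codim (F : fieldType) (vT : vectType F) (V : {vspace vT}) : nat :=
  (\dim {:vT} - \dim V)%N.

Section Arrangement.
Variables (R : realType) (k : nat).
Implicit Types a : 'rV[R]_k.

Definition hyperplane a : {vspace 'rV[R]_k} := lker (linfun (mulmxr a^T)).

Definition translate a (s : R) : set 'rV[R]_k :=
  [set h + s *: a | h in [set h | h \in hyperplane a]].

Variables (n : nat) (alpha : 'I_n -> 'rV[R]_k).

Definition generic_arrangement : Prop :=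
  (forall i, alpha i != 0) /\
  (forall I : {set 'I_n}, (#|I| <= k)%N ->
     codim (\bigcap_(i in I) hyperplane (alpha i))%VS = #|I|).

Definition D_hyp (L : {set 'I_n}) : set 'rV[R]_n :=
  [set t | \bigcap_(i in [set` L]) translate (alpha i) (t 0 i) !=set0].

(* Only meant for index sets S with more than k elements. *)
Definition D (S : {set 'I_n}) : set 'rV[R]_n :=
  \bigcap_(L in [set L : {set 'I_n} | L \subset S /\ #|L| = k.+1]) D_hyp L.

(* The hyperplanes of the discriminantal arrangement all contain 0, so its
   intersections are linear subspaces. The empty family E gives the whole
   space. *)
Definition in_poset (X : {vspace 'rV[R]_n}) : Prop :=
  exists E : {set {set 'I_n}},
    (forall L, L \in E -> #|L| = k.+1) /\
    [set t | t \in X] = \bigcap_(L in [set` E]) D_hyp L.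

Definition component (X : {vspace 'rV[R]_n}) (S : {set 'I_n}) : Prop :=
  [/\ (k < #|S|)%N,
      [set t | t \in X] `<=` D S
    & forall j, j \notin S -> ~ ([set t | t \in X] `<=` D (j |: S)%SET)].

Definition canonical_presentation (X : {vspace 'rV[R]_n}) : {set {set 'I_n}} :=
  [set S : {set 'I_n} | `[< component X S >]]%SET.

(* The subtraction is not truncated, since components have #|S| > k. *)
Definition athanasiadis_rank (X : {vspace 'rV[R]_n}) : nat :=
  (\sum_(S in canonical_presentation X) (#|S| - k))%N.

Definition very_generic (X : {vspace 'rV[R]_n}) : Prop :=
  codim X = athanasiadis_rank X.

Definition minimal_non_very_generic (X : {vspace 'rV[R]_n}) : Prop :=
  [/\ in_poset X, ~ very_generic X
    & forall Y : {vspace 'rV[R]_n},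
        in_poset Y -> (X <= Y)%VS -> X <> Y -> very_generic Y].

End Arrangement.

(* Main.v *)
Require Import Defs.
From HB Require Import structures.
From mathcomp Require Import all_boot all_order all_algebra.
From mathcomp Require Import boolp classical_sets reals.
From mathcomp Require Import zify.
Set Implicit Arguments.
Unset Strict Implicit.
Unset Printing Implicit Defensive.
Import Order.TTheory GRing.Theory Num.Theory.
Local Open Scope ring_scope.

                                                                              
                                                                            
                                                                              
                                                                          
                                                                              
                                                                 
                                                                           
                                                                       

(** The bound is a double count. Every index covered by the components of [X] lies in at least two
    of them ([in_two_components]), so twice the size of the union is at most the sum of the |S|; and
    |S| <= (k+1)(|S|-k) as soon as |S| > k. For the two components, suppose that [i] lies in a
    single component [S0]. Let Y be the intersection of all D_L that contain X and have [i] outside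
    L. The i-th coordinate vector lies in Y but not in D_S0, so Y strictly contains X and is very
    generic by minimality. The components of X other than [S0] remain components of Y, and so does
    [S0] without [i] if it has more than k elements; hence a_X <= a_Y + 1 = codim Y + 1 <= codim X.
    Since codim X <= a_X always holds ([codim_le_rank]), X would be very generic. The geometric
    input is that k of the translates meet in one point depending linearly on t
    ([common_point_linear]). Thus D_S says that all translates in S share a point ([DP]), and D_S is
    cut out by |S|-k linear equations ([D_vspace]). *)

(** * Counting in finite sets *)

Lemma subset_of_card (T : finType) (A : {set T}) m :
  (m <= #|A|)%N -> exists2 B : {set T}, B \subset A & #|B| = m.
Proof.
move=> mA; pose B := [set x in take m (enum A)]%SET.
exists B; first by apply/fintype.subsetP => x; rewrite inE => /mem_take; rewrite mem_enum.
rewrite cardsE (card_uniqP _) ?take_uniq ?enum_uniq //.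
by rewrite size_takel // -cardE.
Qed.

(** Double counting of the incidences between points and members of [P]. *)
Lemma sum_card_ge_cover (T : finType) (P : {set {set T}}) m :
  (forall x, x \in finset.cover P -> (m <= #|[set A in P | x \in A]|)%N) ->
  (m * #|finset.cover P| <= \sum_(A in P) #|A|)%N.
Proof.
move=> mP; have -> : (\sum_(A in P) #|A| =
    \sum_(x in finset.cover P) #|[set A in P | x \in A]%SET|)%N.
  under eq_bigr do rewrite -sum1_card.
  rewrite (exchange_big_dep (mem (finset.cover P))) /=; last first.
    by move=> A x AP xA; apply/bigcupP; exists A.
  apply: eq_bigr => x _; rewrite -sum1_card; apply: eq_bigl => A.
  by rewrite inE.
by rewrite mulnC -sum_nat_const; apply: leq_sum => x /mP.
Qed.

(** * Codimension of subspaces *)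

Section Codim.
Variables (F : fieldType) (vT : vectType F).
Implicit Types U V : {vspace vT}.

Lemma codim_cap U V : (codim (U :&: V)%VS <= codim U + codim V)%N.
Proof.
rewrite /codim; have := dimv_sum_cap U V.
have := dimvS (subvf (U + V)%VS); have := dimvS (subvf U).
have := dimvS (subvf V); lia.
Qed.

Lemma codim_bigcap (I : finType) (P : pred I) (V : I -> {vspace vT}) :
  (codim (\bigcap_(i | P i) V i)%VS <= \sum_(i | P i) codim (V i))%N.
Proof.
elim/big_rec2: _ => [|i m U _ IH]; first by rewrite /codim subnn.
by apply: leq_trans (codim_cap _ _) _; rewrite leq_add2l.
Qed.

Lemma codim_ltn U V : (U <= V)%VS -> U != V -> (codim V < codim U)%N.
Proof.
move=> UV; rewrite eqEdim UV /= -ltnNge /codim => lt.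
have := dimvS (subvf V); lia.
Qed.

Lemma codim_lker (wT : vectType F) (f : 'Hom(vT, wT)) :
  (codim (lker f) <= dim wT)%N.
Proof.
have := limg_ker_dim f fullv; rewrite capfv /codim.
have := dimvS (subvf (limg f)); rewrite [\dim {:wT}]dimvf; lia.
Qed.

Lemma mem_bigcapv (I : finType) (P : pred I) (V : I -> {vspace vT}) u :
  reflect (forall i, P i -> u \in V i) (u \in \bigcap_(i | P i) V i)%VS.
Proof.
rewrite memvE; apply: (iffP subv_bigcapP) => uV i /uV; by rewrite memvE.
Qed.

End Codim.

(** * Common points of translates and the subspaces D_S *)

Section Discriminantal.
Variables (R : realType) (k n : nat) (alpha : 'I_n -> 'rV[R]_k).
Hypothesis generic : generic_arrangement alpha.
Implicit Types (I S T L : {set 'I_n}) (t : 'rV[R]_n) (x : 'rV[R]_k).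

Definition dot (u v : 'rV[R]_k) : R := (u *m v^T) 0 0.

(** The equations of the translates: [x] lies on all those indexed by [S], see [translateE]. *)
Definition common_point S t x : Prop :=
  forall i, i \in S -> dot x (alpha i) = t 0 i * dot (alpha i) (alpha i).

Lemma dot_self_neq0 (u : 'rV[R]_k) : u != 0 -> dot u u != 0.
Proof.
apply: contraNneq; rewrite /dot mxE => /eqP.
rewrite psumr_eq0 => [/allP u0|j _]; last by rewrite mxE -expr2 sqr_ge0.
apply/eqP/rowP => j; have := u0 j (mem_index_enum j).
by rewrite !mxE /= mulf_eq0 orbb => /eqP.
Qed.

Lemma mem_hyperplane (a x : 'rV[R]_k) : (x \in hyperplane a) = (dot x a == 0).
Proof.
rewrite memv_ker lfunE /= /dot; apply/eqP/eqP => [->|xa]; first by rewrite mxE.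
by apply/matrixP => i j; rewrite !ord1 xa mxE.
Qed.

Lemma translateE (a x : 'rV[R]_k) s :
  translate a s x <-> dot x a = s * dot a a.
Proof.
have dotDZ (h : 'rV[R]_k) r : dot (h + r *: a) a = dot h a + r * dot a a.
  by rewrite /dot mulmxDl -scalemxAl !mxE.
split=> [[h /=]|xa].
  by rewrite mem_hyperplane => /eqP ha <-; rewrite dotDZ ha add0r.
exists (x - s *: a); last by rewrite subrK.
by rewrite /= mem_hyperplane -scaleNr dotDZ xa mulNr subrr.
Qed.

Lemma D_hypP L t : D_hyp alpha L t <-> exists x, common_point L t x.
Proof.
split=> [[x xL]|[x xL]]; exists x => i iL; last by apply/translateE/xL.
by apply/translateE; apply: xL.
Qed.

Lemma common_pointS S T t x :
  S \subset T -> common_point T t x -> common_point S t x.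
Proof. by move=> /fintype.subsetP ST xT i /ST /xT. Qed.

                                                                           
(** By genericity the k normals indexed by [I] are independent, so the equations form an invertible
    square system whose right-hand side is linear in [t]. *)
Lemma common_point_linear I : #|I| = k ->
  exists C : 'M[R]_(n, k), forall t x, common_point I t x <-> x = t *m C.
Proof.
move=> cI.
pose g (j : 'I_k) : 'I_n := enum_val (cast_ord (esym cI) j).
have gI j : g j \in I by apply: enum_valP.
have gsurj i : i \in I -> exists j, i = g j.
  move=> iI; exists (cast_ord cI (enum_rank_in iI i)).
  by rewrite /g cast_ordK enum_rankK_in.
pose A : 'M[R]_k := \matrix_(j, l) alpha (g l) 0 j.
have xA (x : 'rV[R]_k) l : (x *m A) 0 l = dot x (alpha (g l)).
  by rewrite /dot !mxE; apply: eq_bigr => j _; rewrite !mxE.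
(* A vector killed by [A] lies in k hyperplanes whose intersection has codimension k, hence is
   zero. *)
have Au : A \in unitmx.
  rewrite -row_free_unit -kermx_eq0; apply/rowV0P => x /sub_kermxP xA0.
  have /eqP : codim (\bigcap_(i in I) hyperplane (alpha i))%VS = #|I|.
    by apply: (generic.2 I); rewrite cI.
  set V := (\bigcap_(i in I) _)%VS => cV.
  have xV : x \in V.
    apply/mem_bigcapv => i /gsurj [j ->].
    by rewrite mem_hyperplane -xA xA0 mxE.
  have V0 : \dim V = 0%N.
    move: cV; rewrite cI /codim dimvf /dim /= mul1n.
    have := dimvS (subvf V); rewrite dimvf /dim /= mul1n; lia.
  by apply/eqP; move/eqP: V0 xV; rewrite dimv_eq0 => /eqP ->; rewrite memv0.
pose B : 'M[R]_(n, k) :=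
  \matrix_(i, l) ((i == g l)%:R * dot (alpha i) (alpha i)).
have tB t l : (t *m B) 0 l = t 0 (g l) * dot (alpha (g l)) (alpha (g l)).
  rewrite mxE (bigD1 (g l)) //= big1 => [|i /negPf ig]; last first.
    by rewrite mxE ig mul0r mulr0.
  by rewrite mxE eqxx mul1r addr0.
exists (B *m invmx A) => t x; split=> [xI|-> i /gsurj [l ->]].
  rewrite mulmxA; apply: (canRL (mulmxK Au)).
  by apply/rowP => l; rewrite xA tB xI.
by rewrite -xA mulmxA mulmxKV // tB.
Qed.

Lemma common_point_uniq S t x y : (k <= #|S|)%N ->
  common_point S t x -> common_point S t y -> x = y.
Proof.
move=> /subset_of_card [I IS cI] xS yS.
have [C CP] := common_point_linear cI.
have /CP -> := common_pointS IS xS.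
by have /CP -> := common_pointS IS yS.
Qed.

(** Fix k indices [I] in [S]. They determine one point, and for each further [j] the set of k+1
    indices [j |: I] forces that same point onto the translate of [j]. *)
Lemma DP S t : (k < #|S|)%N ->
  D alpha S t <-> exists x, common_point S t x.
Proof.
move=> kS; split=> [tS|[x xS] L [LS _]]; last first.
  by apply/D_hypP; exists x; apply: common_pointS xS.
have [I IS cI] := subset_of_card (ltnW kS).
have [C CP] := common_point_linear cI.
exists (t *m C) => j jS; have [jI|jI] := boolP (j \in I).
  by have /CP := erefl (t *m C); apply.
have /D_hypP [x xL] : D_hyp alpha (j |: I) t.
  by apply: tS; rewrite /= finset.subUset finset.sub1set jS IS cardsU1 jI cI.
have /CP <- := common_pointS (finset.subsetUr [set j]%SET I) xL.
by apply: xL; rewrite finset.setU11.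
Qed.

Lemma D_hyp_D L : #|L| = k.+1 -> D_hyp alpha L = D alpha L.
Proof.
move=> cL; apply/seteqP; split=> t.
  by move/D_hypP => tL; apply/DP => //; rewrite cL.
by move/DP => tL; apply/D_hypP/tL; rewrite cL.
Qed.

Lemma D_sub S T : T \subset S -> (D alpha S `<=` D alpha T)%classic.
Proof.
by move=> TS t tS L [LT cL]; apply: tS; split=> //; apply: fintype.subset_trans TS.
Qed.

(** The common points for [S] and for [T] agree, because k shared indices already determine them. *)
Lemma D_glue S T : (k < #|S|)%N -> (k < #|T|)%N -> (k <= #|S :&: T|)%N ->
  (D alpha S `&` D alpha T `<=` D alpha (S :|: T))%classic.
Proof.
move=> kS kT kST t [/(DP _ kS) [x xS] /(DP _ kT) [y yT]].
have kU : (k < #|S :|: T|)%N.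
  by apply: leq_trans kS _; apply/subset_leq_card/finset.subsetUl.
apply/DP => //; exists x => i; rewrite finset.in_setU => /orP [/xS //|iT].
suff -> : x = y by apply: yT.
apply: (common_point_uniq kST).
  exact: common_pointS (finset.subsetIl S T) xS.
exact: common_pointS (finset.subsetIr S T) yT.
Qed.

(** Once k indices of [S] have fixed the point, each of the remaining |S|-k indices imposes one
    linear condition on [t]. *)
Lemma D_vspace S : (k < #|S|)%N -> exists V : {vspace 'rV[R]_n},
  (forall t, t \in V <-> D alpha S t) /\ (codim V <= #|S| - k)%N.
Proof.
move=> kS; have [I IS cI] := subset_of_card (ltnW kS).
have [C CP] := common_point_linear cI.
pose h (l : 'I_#|S :\: I|) : 'I_n := enum_val l.
(* Column [l] measures how far the point [t *m C] is from satisfying the equation of index [h l]. *)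
pose M : 'M[R]_(n, #|S :\: I|) := \matrix_(i, l)
  ((C *m (alpha (h l))^T) i 0 - (i == h l)%:R * dot (alpha i) (alpha i)).
have tM t l : (t *m M) 0 l =
    dot (t *m C) (alpha (h l)) - t 0 (h l) * dot (alpha (h l)) (alpha (h l)).
  rewrite /dot -mulmxA [in RHS]mxE [in LHS]mxE.
  under eq_bigr do rewrite mxE mulrBr.
  rewrite sumrB; congr (_ - _).
  rewrite (bigD1 (h l)) //= big1 => [|i /negPf ig]; last by rewrite ig mul0r mulr0.
  by rewrite eqxx mul1r addr0.
exists (lker (linfun (mulmxr M))); split=> [t|]; last first.
  apply: leq_trans (codim_lker _) _; rewrite /dim /= mul1n.
  by rewrite cardsD (finset.setIidPr IS) cI.
rewrite memv_ker lfunE /=; split=> [/eqP tM0|/(DP _ kS) [x xS]].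
  apply/DP => //; exists (t *m C) => j jS; have [jI|jI] := boolP (j \in I).
    by have /CP := erefl (t *m C); apply.
  have jSI : j \in S :\: I by rewrite inE jI.
  apply/eqP; rewrite -subr_eq0.
  have := tM t (enum_rank_in jSI j); rewrite tM0 mxE /h enum_rankK_in //.
  by move=> <-.
apply/eqP/rowP => l; rewrite tM mxE.
have /CP <- := common_pointS IS xS.
have := enum_valP l; rewrite inE => /andP [_ lS].
by rewrite xS // subrr.
Qed.

(** Only the hyperplane of index [i] is moved: the k others meet just at the origin, which is off
    the translate. *)
Lemma delta_notin_D_hyp L i : #|L| = k.+1 -> i \in L ->
  ~ D_hyp alpha L (delta_mx 0 i).
Proof.
move=> cL iL /D_hypP [x xL].
have cI : #|L :\ i| = k by move: (cardsD1 i L); rewrite iL cL => -[].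
have x0 : x = 0.
  apply: (@common_point_uniq (L :\ i) (delta_mx 0 i)); first by rewrite cI.
    exact: common_pointS (finset.subD1set _ _) xL.
  move=> j; rewrite !inE => /andP [/negPf ji _].
  by rewrite /dot mul0mx !mxE ji !mul0r.
have := xL i iL; rewrite x0 /dot mul0mx !mxE !eqxx mul1r => /esym/eqP.
by apply/negP; have := dot_self_neq0 (generic.1 i); rewrite /dot mxE.
Qed.

Lemma delta_in_D_hyp L i : i \notin L -> D_hyp alpha L (delta_mx 0 i).
Proof.
move=> iL; apply/D_hypP; exists 0 => j jL.
have /negPf ji : j != i by apply: contraNneq iL => <-.
by rewrite /dot mul0mx !mxE ji andbF mul0r.
Qed.

Lemma in_poset_bigcap (E : {set {set 'I_n}}) :
  (forall L, L \in E -> #|L| = k.+1) ->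
  exists2 Y : {vspace 'rV[R]_n}, in_poset alpha Y &
    forall t, t \in Y <-> (forall L, L \in E -> D_hyp alpha L t).
Proof.
move=> cE.
have /boolp.choice [V VP] L : exists V : {vspace 'rV[R]_n},
    L \in E -> forall t, t \in V <-> D_hyp alpha L t.
  (* Outside [E] the zero space is a dummy value. *)
  have [LE|_] := boolP (L \in E); last by exists 0%VS.
  have cL := cE _ LE; have [|V [VP _]] := @D_vspace L; first by rewrite cL.
  by exists V => _ t; rewrite D_hyp_D.
pose Y := (\bigcap_(L in E) V L)%VS.
have YP t : t \in Y <-> (forall L, L \in E -> D_hyp alpha L t).
  split=> [/mem_bigcapv tY L LE|tE]; first exact/(VP _ LE)/tY.
  by apply/mem_bigcapv => L LE; apply/(VP _ LE)/tE.
by exists Y => //; exists E; split=> //; apply/seteqP; split=> t /YP.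
Qed.

(** * Components of an intersection and the index count *)

Section Intersection.
Variable X : {vspace 'rV[R]_n}.
Hypothesis X_in : in_poset alpha X.
Local Notation sub_D X S := ([set t | t \in X] `<=` D alpha S)%classic.

Lemma mem_presentation (Y : {vspace 'rV[R]_n}) S :
  reflect (component alpha Y S) (S \in canonical_presentation alpha Y).
Proof. by rewrite inE; apply: asboolP. Qed.

Lemma component_exists S : (k < #|S|)%N -> sub_D X S ->
  exists2 T : {set 'I_n}, component alpha X T & S \subset T.
Proof.
move=> kS XS; have PS : [pred T : {set 'I_n} | `[< sub_D X T >]] S.
  exact/asboolP.
have [T /maxsetP [/asboolP XT maxT] ST] := maxset_exists PS.
exists T => //; split=> //; first exact: leq_trans kS (subset_leq_card ST).
move=> j jT XjT; have := maxT (j |: T)%SET.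
move=> /(_ (introT (asboolP _) XjT) (finset.subsetUr _ _)) /setP /(_ j).
by rewrite finset.setU11 (negPf jT).
Qed.

(** Each D_L defining [X] contains D_T for a component T including L, so [X] is the intersection of
    its D_T. *)
Lemma mem_XP t : (forall S, component alpha X S -> D alpha S t) -> t \in X.
Proof.
have [E [cE EX]] := X_in => tS.
suff : [set t | t \in X]%classic t by [].
rewrite EX => L LE; have cL := cE _ LE.
have XL : sub_D X L by rewrite -D_hyp_D // EX => u /(_ L LE).
have [|T XT LT] := component_exists _ XL; first by rewrite cL.
by rewrite D_hyp_D //; apply: D_sub LT _ (tS _ XT).
Qed.

Lemma codim_le_rank : (codim X <= athanasiadis_rank alpha X)%N.
Proof.
have /boolp.choice [V VP] S : exists V : {vspace 'rV[R]_n},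
    (k < #|S|)%N ->
    (forall t, t \in V <-> D alpha S t) /\ (codim V <= #|S| - k)%N.
  have [/D_vspace [V VP]|_] := boolP (k < #|S|)%N; last by exists 0%VS.
  by exists V.
have VX : (\bigcap_(S in canonical_presentation alpha X) V S <= X)%VS.
  apply/subvP => t /mem_bigcapv tV; apply: mem_XP => S XS.
  have [kS _ _] := XS; have [VD _] := VP _ kS.
  by apply/VD/tV/mem_presentation.
apply: leq_trans (leq_sub2l _ (dimvS VX)) _.
apply: leq_trans (codim_bigcap _ _) _.
by apply: leq_sum => S /mem_presentation [kS _ _]; have [] := VP _ kS.
Qed.

(** If [i] were in one component only, dropping the conditions involving [i] would lower the
    Athanasiadis rank by at most one and the codimension by at least one. *)
Lemma in_two_components i :
  ~ very_generic alpha X ->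
  (forall Y : {vspace 'rV[R]_n}, in_poset alpha Y -> (X <= Y)%VS -> X <> Y ->
    very_generic alpha Y) ->
  i \in finset.cover (canonical_presentation alpha X) ->
  (2 <= #|[set S in canonical_presentation alpha X | i \in S]|)%N.
Proof.
move=> XnV Xmin /bigcupP [S0 /[dup] PS0 /mem_presentation XS0 iS0].
have [kS0 XDS0 S0max] := XS0.
set P := canonical_presentation alpha X in PS0 *.
rewrite ltnNge; apply/negP => /card_le1_eqP uniqS.
have otherS S : S \in P -> S != S0 -> i \notin S.
  move=> PS; apply: contra => iS; apply/eqP.
  by apply: uniqS; rewrite inE ?PS ?PS0.
pose E := [set L : {set 'I_n} |
  [&& #|L| == k.+1, i \notin L & `[< sub_D X L >]]]%SET.
have EP L : L \in E -> [/\ #|L| = k.+1, i \notin L & sub_D X L].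
  by rewrite inE => /and3P [/eqP ? ? /asboolP].
have [|Y Yin YP] := @in_poset_bigcap E; first by move=> L /EP [].
have XY : (X <= Y)%VS.
  apply/subvP => t tX; apply/YP => L /EP [cL _ XL].
  by rewrite D_hyp_D //; apply: XL.
have iY : delta_mx 0 i \in Y.
  by apply/YP => L /EP [_ iL _]; apply: delta_in_D_hyp.
(* Such an [S] contains a set of k+1 indices through [i], and there the coordinate vector in [Y]
   fails. *)
have not_sub_D_Y S : (k < #|S|)%N -> i \in S -> ~ sub_D Y S.
  move=> kS iS YS.
  have [|J JS cJ] := @subset_of_card _ (S :\ i) k.
    by move: kS; rewrite (cardsD1 i) iS.
  have iJ : i \notin J by apply/negP => /(fintype.subsetP JS); rewrite !inE eqxx.
  have cL : #|i |: J| = k.+1 by rewrite cardsU1 iJ cJ.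
  apply: (delta_notin_D_hyp cL (finset.setU11 _ _)); apply: (YS _ iY); split=> //.
  by rewrite finset.subUset finset.sub1set iS (fintype.subset_trans JS) // finset.subD1set.
have XneY : X != Y.
  apply/eqP => XeqY; apply: (not_sub_D_Y S0) => //.
  by rewrite -XeqY.
have sub_D_Y S : sub_D X S -> i \notin S -> sub_D Y S.
  move=> XS iS t /YP tE L [LS cL]; apply: tE; rewrite inE cL eqxx /=.
  apply/andP; split; first by apply: contra iS; apply/fintype.subsetP.
  by apply/asboolP => u /XS; apply: D_sub.
have YX S : sub_D Y S -> sub_D X S by move=> YS t /(subvP XY); apply: YS.
have compY S : S \in P -> S != S0 -> S \in canonical_presentation alpha Y.
  move=> PS SS0; have [kS XS maxS] := mem_presentation _ _ PS.
  apply/mem_presentation; split=> //; first by apply: sub_D_Y => //; apply: otherS.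
  by move=> j jS /YX; apply: maxS.
(* Maximality: [i] cannot be added back, by [not_sub_D_Y]; adding some [j] outside [S0] and gluing
   with [S0] along [S0 :\ i] would enlarge [S0] as a component of [X]. *)
have compY0 : (k < #|S0 :\ i|)%N ->
    S0 :\ i \in canonical_presentation alpha Y.
  move=> kS; apply/mem_presentation; split=> //.
    apply: sub_D_Y; last by rewrite !inE eqxx.
    by move=> t /XDS0; apply: D_sub; apply: finset.subD1set.
  have sub_card (A : {set 'I_n}) : S0 :\ i \subset A -> (k < #|A|)%N.
    by move=> sA; apply: leq_trans kS (subset_leq_card sA).
  move=> j; rewrite !inE negb_and negbK => /orP [/eqP ->|jS0].
    by rewrite finset.setD1K //; apply: not_sub_D_Y.
  move=> /YX XjS; apply: (S0max j jS0) => t tX.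
  have -> : (j |: S0 = (j |: S0 :\ i) :|: S0)%SET.
    by rewrite -finset.setUA; congr (_ :|: _); apply/esym/finset.setUidPr/finset.subD1set.
  apply: D_glue => //; first exact/sub_card/finset.subsetUr.
    apply/ltnW/sub_card; rewrite finset.subsetI finset.subsetUr.
    exact: finset.subD1set.
  by split; [apply: XjS | apply: XDS0].
have rankY : (athanasiadis_rank alpha X <= (athanasiadis_rank alpha Y).+1)%N.
  rewrite /athanasiadis_rank (bigD1 S0) //=.
  have cS0 : #|S0| = #|S0 :\ i|.+1 by rewrite (cardsD1 i) iS0.
  set Q := canonical_presentation alpha Y in compY compY0 *.
  have leQ (p : pred {set 'I_n}) :
      (forall S, S \in P -> S != S0 -> p S) ->
      (\sum_(S in P | S != S0) (#|S| - k) <= \sum_(S in Q | p S) (#|S| - k))%N.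
    move=> Pp; rewrite [leqRHS](bigID [pred S | (S \in P) && (S != S0)]) /=.
    apply: leq_trans (leq_addr _ _); apply: eq_leq; apply: eq_bigl => S.
    have [PS|_] := boolP (S \in P); last by rewrite andbF.
    have [->|SS0] /= := eqVneq S S0; first by rewrite andbF.
    by rewrite compY // Pp.
  (* Either [S0] shrinks and its term drops by one, or |S0| = k+1 and its term, equal to 1, is
     lost. *)
  have [kS|kS] := ltnP k #|S0 :\ i|.
    rewrite [in leqRHS](bigD1 (S0 :\ i)) ?compY0 //= cS0 subSn; last exact: ltnW.
    rewrite addSn ltnS leq_add2l; apply: leQ => S PS SS0.
    (* [S0 :\ i] is not a component of [X], since [i] can be added to it; so its term is not counted
       twice. *)
    apply: contraTneq PS => ->; apply/negP => /mem_presentation [_ _ /(_ i)].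
    by rewrite !inE eqxx finset.setD1K // => /(_ isT).
  rewrite -add1n; apply: leq_add; first by rewrite leq_subLR cS0 addn1 ltnS.
  by have := leQ predT (fun _ _ _ => isT); under [leqRHS]eq_bigl do rewrite andbT.
apply: XnV; apply/eqP; rewrite /very_generic eqn_leq codim_le_rank /=.
apply: leq_trans rankY _; rewrite -(Xmin Y) //; last exact/eqP.
exact: codim_ltn.
Qed.

End Intersection.
End Discriminantal.

Theorem theorem4p7 (R : realType) (k n : nat) (alpha : 'I_n -> 'rV[R]_k)
    (X : {vspace 'rV[R]_n}) :
  (k < n)%N ->
  generic_arrangement alpha ->
  minimal_non_very_generic alpha X ->
  (2 * #|finset.cover (canonical_presentation alpha X)|)%:R / k.+1%:R
    <= (athanasiadis_rank alpha X)%:R :> R.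
Proof.
move=> _ generic [X_in XnV Xmin].
rewrite ler_pdivrMr ?ltr0Sn // -natrM ler_nat.
apply: leq_trans (sum_card_ge_cover _) _.
  by move=> i; apply: in_two_components.
rewrite /athanasiadis_rank big_distrl /=.
apply: leq_sum => S /mem_presentation [kS _ _].
(* With |S| = k+1+d the claim is k+1+d <= (d+1)(k+1). *)
rewrite -(subnKC kS); move: (#|S| - k.+1)%N => d; nia.
Qed.
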